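(* Let $\mathrm{Ax}$ be a set of consequence pairs each of which is one of $\mathsf{refl}:\ \top\trianglelefteq p\Rightarrow p$, $\mathsf{cond}:\ p\trianglelefteq\top\Rightarrow p$, $\mathsf{veq}:\ p\trianglelefteq q\Rightarrow p$, $\mathsf{cs}:\ p\wedge q\trianglelefteq p\Rightarrow q$, $\mathsf{det}:\ \top\Rightarrow p\trianglelefteq p$, $\mathsf{expl}:\ \top\trianglelefteq\bot\Rightarrow p$, or is a consequence pair containing no occurrence of $\Rightarrow$. Then $\mathbf{CL}(\mathrm{Ax})$ is sound and complete with respect to the class of selection L-frames that validate every consequence pair in $\mathrm{Ax}$: a consequence pair belongs to $\mathbf{CL}(\mathrm{Ax})$ iff it is validated by every selection L-frame validating all of $\mathrm{Ax}$.
   Context: Formulas: $\phi::=p\mid\top\mid\bot\mid\phi\wedge\phi\mid\phi\vee\phi\mid\phi\Rightarrow\phi$. $\mathbf{CL}(\Gamma)$ is the smallest set of consequence pairs $\phi\trianglelefteq\psi$ containing $\Gamma$, closed under uniform substitution, containing $p\trianglelefteq\top$, $\bot\trianglelefteq p$, $p\trianglelefteq p$, $p\wedge q\trianglelefteq p$, $p\wedge q\trianglelefteq q$, $p\trianglelefteq p\vee q$, $q\trianglelefteq p\vee q$, $\top\trianglelefteq p\Rightarrow\top$, $p\Rightarrow(q\wedge r)\trianglelefteq(p\Rightarrow q)\wedge(p\Rightarrow r)$, $(p\Rightarrow q)\wedge(p\Rightarrow r)\trianglelefteq p\Rightarrow(q\wedge r)$, closed under transitivity, $\wedge$-introduction (from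 $r\trianglelefteq p,r\trianglelefteq q$ infer $r\trianglelefteq p\wedge q$), $\vee$-elimination (from $p\trianglelefteq r,q\trianglelefteq r$ infer $p\vee q\trianglelefteq r$), and congruence for $\Rightarrow$ in each argument. A selection L-frame is a meet-semilattice $(X,1,\curlywedge)$ ($x\preccurlyeq y$ iff $x\curlywedge y=x$) with $s:X\times\mathcal F(X)\to\mathcal F(X)$ ($\mathcal F(X)$ the filters: upward closed, closed under finite meets) such that $s(1,a)=\{1\}$; $x\preccurlyeq y$ implies $s(y,a)\subseteq s(x,a)$; if $z\in s(x\curlywedge y,a)$ there are $u\in s(x,a)$, $v\in s(y,a)$ with $u\curlywedge v\preccurlyeq z$. Under a valuation $V$ (letters to filters): $x\Vdash p$ iff $x\in V(p)$; $\top$ always; $x\Vdash\bot$ iff $x=1$; $\wedge$ pointwise; $x\Vdash\phi\vee\psi$ iff some $y\Vdash\phi$, $z\Vdash\psi$ have $y\curlywedge z\preccurlyeq x$; $x\Vdash\phi\Rightarrow\psi$ iff $s(x,[\![\phi]\!])\subseteq[\![\psi]\!]$. A frame validates $\phi\trianglelefteq\psi$ if $[\![\phi]\!]\subseteq[\![\psi]\!]$ for all valuations. *)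

(* Defs.v *)
From HB Require Import structures.
From mathcomp Require Import all_boot all_order.
From mathcomp Require Import boolp classical_sets.

Set Implicit Arguments.
Unset Strict Implicit.
Unset Printing Implicit Defensive.

Import Order.Theory.
Local Open Scope classical_set_scope.

Inductive formula : Type :=
| Var of nat
| Top
| Bot
| And of formula & formula
| Or of formula & formula
| Imp of formula & formula.

Declare Scope formula_scope.
Delimit Scope formula_scope with F.
Bind Scope formula_scope with formula.
Notation "⊤" := Top : formula_scope.
Notation "⊥" := Bot : formula_scope.
Notation "φ ∧ ψ" := (And φ ψ) (at level 40, left associativity) : formula_scope.
Notation "φ ∨ ψ" := (Or φ ψ) (at level 50, left associativity) : formula_scope.
Notation "φ ⇒ ψ" := (Imp φ ψ) (at level 55, right associativity) : formula_scope.

Definition cpair : Type := (formula * formula)%type.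
Notation "φ ⊴ ψ" := ((φ%F, ψ%F) : cpair) (at level 60, no associativity).

Fixpoint subst (σ : nat -> formula) (φ : formula) : formula :=
  match φ with
  | Var n => σ n
  | Top => Top
  | Bot => Bot
  | And φ1 φ2 => And (subst σ φ1) (subst σ φ2)
  | Or φ1 φ2 => Or (subst σ φ1) (subst σ φ2)
  | Imp φ1 φ2 => Imp (subst σ φ1) (subst σ φ2)
  end.

Fixpoint imp_free (φ : formula) : bool :=
  match φ with
  | Var _ | Top | Bot => true
  | And φ1 φ2 | Or φ1 φ2 => imp_free φ1 && imp_free φ2
  | Imp _ _ => false
  end.

(* The letters p, q, r in which the axioms are written.  The choice is
   immaterial, since CL is closed under uniform substitution and validity
   quantifies over all valuations. *)
Local Notation p := (Var 0).
Local Notation q := (Var 1).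
Local Notation r := (Var 2).

Inductive CL (Γ : set cpair) : set cpair :=
| CL_hyp c : Γ c -> CL Γ c
| CL_subst σ φ ψ : CL Γ (φ ⊴ ψ) -> CL Γ (subst σ φ ⊴ subst σ ψ)
| CL_top : CL Γ (p ⊴ ⊤)
| CL_bot : CL Γ (⊥ ⊴ p)
| CL_id : CL Γ (p ⊴ p)
| CL_andl : CL Γ (p ∧ q ⊴ p)
| CL_andr : CL Γ (p ∧ q ⊴ q)
| CL_orl : CL Γ (p ⊴ p ∨ q)
| CL_orr : CL Γ (q ⊴ p ∨ q)
| CL_imp_top : CL Γ (⊤ ⊴ p ⇒ ⊤)
| CL_imp_and : CL Γ (p ⇒ (q ∧ r) ⊴ (p ⇒ q) ∧ (p ⇒ r))
| CL_and_imp : CL Γ ((p ⇒ q) ∧ (p ⇒ r) ⊴ p ⇒ (q ∧ r))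
| CL_trans φ ψ χ : CL Γ (φ ⊴ ψ) -> CL Γ (ψ ⊴ χ) -> CL Γ (φ ⊴ χ)
| CL_and_intro φ ψ χ : CL Γ (χ ⊴ φ) -> CL Γ (χ ⊴ ψ) -> CL Γ (χ ⊴ φ ∧ ψ)
| CL_or_elim φ ψ χ : CL Γ (φ ⊴ χ) -> CL Γ (ψ ⊴ χ) -> CL Γ (φ ∨ ψ ⊴ χ)
| CL_congl φ ψ χ : CL Γ (φ ⊴ ψ) -> CL Γ (ψ ⊴ φ) -> CL Γ (φ ⇒ χ ⊴ ψ ⇒ χ)
| CL_congr φ ψ χ : CL Γ (φ ⊴ ψ) -> CL Γ (ψ ⊴ φ) -> CL Γ (χ ⇒ φ ⊴ χ ⇒ ψ).

Definition ax_refl := ⊤ ⊴ p ⇒ p.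
Definition ax_cond := p ⊴ ⊤ ⇒ p.
Definition ax_veq := p ⊴ q ⇒ p.
Definition ax_cs := p ∧ q ⊴ p ⇒ q.
Definition ax_det := ⊤ ⇒ p ⊴ p.
Definition ax_expl := ⊤ ⊴ ⊥ ⇒ p.

Definition named_axioms : set cpair :=
  [set ax_refl; ax_cond; ax_veq; ax_cs; ax_det; ax_expl].

Definition imp_free_pairs : set cpair :=
  [set c | imp_free c.1 && imp_free c.2].

(* tMeetSemilatticeType also bundles a choice operator and a boolean order;
   by the classical axioms of boolp every meet-semilattice with top carries
   these, so ranging over this structure loses no frames.
   Filters contain the top element, the meet of the empty family. *)
Record order_filter d (X : tMeetSemilatticeType d) := Filter {
  fset :> set X;
  filter_top : fset \top%O;
  filter_up : forall x y : X, (x <= y)%O -> fset x -> fset y;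
  filter_meet : forall x y : X, fset x -> fset y -> fset (Order.meet x y) }.

Lemma filter_eq d (X : tMeetSemilatticeType d) (a b : order_filter X) :
  fset a = fset b -> a = b.
Proof.
case: a b => [a a1 a2 a3] [b b1 b2 b3] /= eab; subst b.
by congr Filter; exact: Prop_irrelevance.
Qed.

Record selection_frame d (X : tMeetSemilatticeType d) := SelectionFrame {
  sel :> X -> order_filter X -> order_filter X;
  sel_top : forall a, fset (sel \top%O a) = [set \top%O];
  sel_anti : forall (x y : X) a, (x <= y)%O -> sel y a `<=` sel x a;
  sel_meet : forall (x y : X) a z, fset (sel (Order.meet x y) a) z ->
    exists u v, [/\ fset (sel x a) u, fset (sel y a) v & (Order.meet u v <= z)%O] }.

Section FilterOperations.
Variables (d : Order.disp_t) (X : tMeetSemilatticeType d).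

#[local] Obligation Tactic := idtac.

Program Definition filterT : order_filter X := @Filter _ _ setT _ _ _.
Solve All Obligations with by [].

Program Definition filter1 : order_filter X := @Filter _ _ [set \top%O] _ _ _.
Next Obligation. by []. Qed.
Next Obligation. by move=> x y /= xy x1; apply/eqP; rewrite -le1x -x1. Qed.
Next Obligation. by move=> x y /= -> ->; rewrite meetxx. Qed.

Program Definition filterI (a b : order_filter X) : order_filter X :=
  @Filter _ _ (a `&` b) _ _ _.
Next Obligation. by move=> a b; split; exact: filter_top. Qed.
Next Obligation.
by move=> a b x y xy [ax bx]; split; exact: filter_up xy _.
Qed.
Next Obligation.
by move=> a b x y [ax bx] [ay bY]; split; exact: filter_meet.
Qed.

Program Definition filterJ (a b : order_filter X) : order_filter X :=
  @Filter _ _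
    [set x | exists y z, [/\ fset a y, fset b z & (Order.meet y z <= x)%O]]
    _ _ _.
Next Obligation.
by move=> a b; exists \top%O, \top%O; split;
  [exact: filter_top | exact: filter_top | exact: lex1].
Qed.
Next Obligation.
move=> a b x y xy [u [v [au bv uvx]]].
by exists u, v; split => //; exact: le_trans xy.
Qed.
Next Obligation.
move=> a b x y [u [v [au bv uvx]]] [u' [v' [au' bv' uvy]]].
exists (Order.meet u u'), (Order.meet v v').
by split; [exact: filter_meet | exact: filter_meet | rewrite meetACA leI2].
Qed.

Variable s : selection_frame X.

Program Definition filter_imp (a b : order_filter X) : order_filter X :=
  @Filter _ _ [set x | s x a `<=` b] _ _ _.
Next Obligation. by move=> a b x; rewrite sel_top => ->; exact: filter_top. Qed.
Next Obligation.
by move=> a b x y xy sxb z syz; apply: sxb; exact: sel_anti xy _ syz.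
Qed.
Next Obligation.
move=> a b x y sx sy z /sel_meet[u [v [su sv uvz]]].
by apply: (filter_up uvz); apply: filter_meet; [exact: sx | exact: sy].
Qed.

Fixpoint interp (V : nat -> order_filter X) (φ : formula) : order_filter X :=
  match φ with
  | Var n => V n
  | Top => filterT
  | Bot => filter1
  | And φ1 φ2 => filterI (interp V φ1) (interp V φ2)
  | Or φ1 φ2 => filterJ (interp V φ1) (interp V φ2)
  | Imp φ1 φ2 => filter_imp (interp V φ1) (interp V φ2)
  end.

Definition validates (c : cpair) : Prop :=
  forall V : nat -> order_filter X, interp V c.1 `<=` interp V c.2.

End FilterOperations.

(* Main.v *)
(** The canonical frame consists of the theories of [CL Ax] ordered by
    inclusion.  A filter of theories is definable when it is the set [⟦φ⟧] of
    the theories containing some formula φ; the selection function sends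
    [(x, ⟦φ⟧)] to the principal filter of the theory [{ψ | φ ⇒ ψ ∈ x}], and
    [(x, a)] to [{1}] when [a] is not definable.  Taking the least filter [{1}]
    in the non-definable case makes refl, veq and cs hold for arbitrary
    valuations, while cond, det and expl only involve the definable filters of
    ⊤ and ⊥.  Implication-free pairs transfer from formulas to arbitrary filters
    because [x ∈ ⟦φ⟧_V] iff there is a choice of theories [v n ∈ V n] such that
    [x] contains every instance [φ[σ]] with [σ n ∈ v n] for all [n]. *)

Require Import Defs.
From HB Require Import structures.
From mathcomp Require Import all_boot all_order.
From mathcomp Require Import boolp classical_sets.
Import Order.Theory.
Local Open Scope classical_set_scope.

(** * Soundness over selection L-frames *)

Section Soundness.
Variables (d : Order.disp_t) (X : tMeetSemilatticeType d).
Variable s : selection_frame X.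

Lemma interp_subst V σ φ :
  interp s V (subst σ φ) = interp s (fun n => interp s V (σ n)) φ.
Proof.
by elim: φ => //= [φ -> ψ ->|φ -> ψ ->|φ -> ψ ->].
Qed.

(** The selection function takes a whole filter as argument, so the congruence rules call for
    equality of interpretations. *)
Lemma interp_equiv V φ ψ : validates s (φ ⊴ ψ) -> validates s (ψ ⊴ φ) ->
  interp s V φ = interp s V ψ.
Proof.
move=> φψ ψφ; apply: filter_eq; rewrite eqEsubset; split.
  exact: φψ.
exact: ψφ.
Qed.

Lemma CL_sound (Γ : set cpair) c :
  (forall a, Γ a -> validates s a) -> CL Γ c -> validates s c.
Proof.
move=> sΓ; elim=> {c}; rewrite /validates //=.
- by move=> σ φ ψ _ IH V; rewrite !interp_subst; apply: IH.
- by move=> V x ->; apply: filter_top.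
- by move=> V x.
- move=> V x Vx; exists x, \top%O; split => //; first exact: filter_top.
  by rewrite meetx1.
- move=> V x Vx; exists \top%O, x; split => //; first exact: filter_top.
  by rewrite meet1x.
- by move=> V x sx; split=> y /sx[].
- by move=> V x [sx1 sx2] y sxy; split; [apply: sx1|apply: sx2].
- by move=> φ ψ χ _ φψ _ ψχ V x /φψ/ψχ.
- by move=> φ ψ χ _ χφ _ χψ V x χx; split; [apply: χφ|apply: χψ].
- move=> φ ψ χ _ φχ _ ψχ V x [y [z [φy ψz yzx]]].
  by apply: filter_up yzx _; apply: filter_meet; [apply: φχ|apply: ψχ].
- by move=> φ ψ χ _ φψ _ ψφ V x; rewrite (interp_equiv V φ ψ).
- by move=> φ ψ χ _ φψ _ ψφ V x; rewrite (interp_equiv V φ ψ).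
Qed.

End Soundness.

(** * Derivable rules of [CL Γ] *)

Section DerivedRules.
Variable Γ : set cpair.

Local Notation "φ ⊢ ψ" := (CL Γ (φ ⊴ ψ)) (at level 70).
Local Notation letters φ ψ χ :=
  (fun n => match n with 0 => φ | 1 => ψ | _ => χ end).

Lemma CL_refl φ : φ ⊢ φ.
Proof. exact: (CL_subst (fun=> φ) (CL_id Γ)). Qed.

Lemma CL_topI φ : φ ⊢ ⊤.
Proof. exact: (CL_subst (fun=> φ) (CL_top Γ)). Qed.

Lemma CL_botE φ : ⊥ ⊢ φ.
Proof. exact: (CL_subst (fun=> φ) (CL_bot Γ)). Qed.

Lemma CL_andE1 φ ψ : φ ∧ ψ ⊢ φ.
Proof. exact: (CL_subst (letters φ ψ ψ) (CL_andl Γ)). Qed.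

Lemma CL_andE2 φ ψ : φ ∧ ψ ⊢ ψ.
Proof. exact: (CL_subst (letters φ ψ ψ) (CL_andr Γ)). Qed.

Lemma CL_orI1 φ ψ : φ ⊢ φ ∨ ψ.
Proof. exact: (CL_subst (letters φ ψ ψ) (CL_orl Γ)). Qed.

Lemma CL_orI2 φ ψ : ψ ⊢ φ ∨ ψ.
Proof. exact: (CL_subst (letters φ ψ ψ) (CL_orr Γ)). Qed.

Lemma CL_imp_topI φ : ⊤ ⊢ φ ⇒ ⊤.
Proof. exact: (CL_subst (fun=> φ) (CL_imp_top Γ)). Qed.

Lemma CL_imp_andI φ ψ χ : (φ ⇒ ψ) ∧ (φ ⇒ χ) ⊢ φ ⇒ ψ ∧ χ.
Proof. exact: (CL_subst (letters φ ψ χ) (CL_and_imp Γ)). Qed.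

(* From ψ ⊢ χ one gets ψ ⊣⊢ ψ ∧ χ, so congruence and distribution over ∧ give
   monotonicity. *)
Lemma CL_imp_mono φ ψ χ : ψ ⊢ χ -> φ ⇒ ψ ⊢ φ ⇒ χ.
Proof.
move=> ψχ; apply: (@CL_trans _ _ (φ ⇒ ψ ∧ χ)%F).
  by apply: CL_congr; [apply: CL_and_intro; [exact: CL_refl|]|exact: CL_andE1].
apply: CL_trans (CL_subst (letters φ ψ χ) (CL_imp_and Γ)) _.
exact: CL_andE2.
Qed.

(** [∧] and [∨] are monotone in both arguments, whereas [⇒] is merely congruential in its first;
    hence the restriction. *)
Lemma CL_subst_mono σ τ φ : imp_free φ -> (forall n, σ n ⊢ τ n) ->
  subst σ φ ⊢ subst τ φ.
Proof.
move=> + στ; elim: φ => //= [_|_|φ IHφ ψ IHψ|φ IHφ ψ IHψ].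
- exact: CL_refl.
- exact: CL_refl.
- case/andP=> /IHφ{}IHφ /IHψ{}IHψ; apply: CL_and_intro.
    exact: CL_trans (CL_andE1 _ _) IHφ.
  exact: CL_trans (CL_andE2 _ _) IHψ.
- case/andP=> /IHφ{}IHφ /IHψ{}IHψ; apply: CL_or_elim.
    exact: CL_trans IHφ (CL_orI1 _ _).
  exact: CL_trans IHψ (CL_orI2 _ _).
Qed.

End DerivedRules.

(** * Theories and their meet-semilattice *)

Record theory (Γ : set cpair) := Theory {
  tset :> set formula;
  theory_top : tset ⊤%F;
  theory_der : forall φ ψ, CL Γ (φ ⊴ ψ) -> tset φ -> tset ψ;
  theory_and : forall φ ψ, tset φ -> tset ψ -> tset (φ ∧ ψ)%F }.

Arguments tset {Γ}.
Arguments theory_top {Γ}.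
Arguments theory_der {Γ} t {φ ψ}.
Arguments theory_and {Γ} t {φ ψ}.

HB.instance Definition _ Γ := gen_eqMixin (theory Γ).
HB.instance Definition _ Γ := gen_choiceMixin (theory Γ).

Section TheorySemilattice.
Variable Γ : set cpair.
Implicit Types x y z : theory Γ.

Lemma theory_eq x y : tset x = tset y -> x = y.
Proof.
case: x y => [x x1 x2 x3] [y y1 y2 y3] /= exy; subst y.
by congr Theory; exact: Prop_irrelevance.
Qed.

#[local] Obligation Tactic := idtac.

Program Definition theoryT : theory Γ := @Theory Γ setT _ _ _.
Solve All Obligations with by [].

Program Definition theoryI x y : theory Γ := @Theory Γ (tset x `&` tset y) _ _ _.
Next Obligation. by move=> x y; split; exact: theory_top. Qed.
Next Obligation.
by move=> x y φ ψ φψ [xφ yφ]; split; exact: theory_der φψ _.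
Qed.
Next Obligation.
by move=> x y φ ψ [xφ yφ] [xψ yψ]; split; exact: theory_and.
Qed.

Definition theory_le x y : bool := `[< tset x `<=` tset y >].

Fact theory_le_refl : reflexive theory_le.
Proof. by move=> x; apply/asboolP. Qed.

Fact theory_le_anti : antisymmetric theory_le.
Proof.
move=> x y /andP[/asboolP xy /asboolP yx].
by apply: theory_eq; rewrite eqEsubset.
Qed.

Fact theory_le_trans : transitive theory_le.
Proof.
move=> y x z /asboolP xy /asboolP yz; apply/asboolP.
exact: subset_trans xy yz.
Qed.

Fact theory_leI x y z : theory_le x (theoryI y z) = theory_le x y && theory_le x z.
Proof.
apply/asboolP/andP => [xyz|[/asboolP xy /asboolP xz] φ xφ].
  by split; apply/asboolP => φ /xyz[].
by split; [exact: xy|exact: xz].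
Qed.

Fact theory_leT x : theory_le x theoryT.
Proof. exact/asboolP. Qed.

End TheorySemilattice.

HB.instance Definition _ Γ := Order.Le_isPOrder.Build (Order.Disp tt tt)
  (theory Γ) (@theory_le_refl Γ) (@theory_le_anti Γ) (@theory_le_trans Γ).
HB.instance Definition _ Γ := Order.POrder_isMeetSemilattice.Build
  (Order.Disp tt tt) (theory Γ) (@theory_leI Γ).
HB.instance Definition _ Γ := Order.hasTop.Build (Order.Disp tt tt)
  (theory Γ) (@theory_leT Γ).

(** * The canonical selection frame *)

Section CanonicalFrame.
Variable Γ : set cpair.
Implicit Types (x y z : theory Γ) (a : order_filter (theory Γ)).

Local Notation "φ ⊢ ψ" := (CL Γ (φ ⊴ ψ)) (at level 70).

Lemma theory_leP x y : reflect (tset x `<=` tset y) (x <= y)%O.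
Proof. exact: asboolP. Qed.

#[local] Obligation Tactic := idtac.

Program Definition theory_gen φ : theory Γ := @Theory Γ [set ψ | φ ⊢ ψ] _ _ _.
Next Obligation. by move=> φ; exact: CL_topI. Qed.
Next Obligation. by move=> φ ψ χ ψχ φψ; exact: CL_trans φψ ψχ. Qed.
Next Obligation. by move=> φ ψ χ; exact: CL_and_intro. Qed.

Program Definition truth_set φ : order_filter (theory Γ) :=
  @Filter _ _ [set x | tset x φ] _ _ _.
Next Obligation. by []. Qed.
Next Obligation. by move=> φ x y /theory_leP xy /xy. Qed.
Next Obligation. by move=> φ x y xφ yφ; split. Qed.

(** Evaluate the inclusion at the least theory containing [φ]. *)
Lemma truth_setS φ ψ : truth_set φ `<=` truth_set ψ -> φ ⊢ ψ.
Proof. by move=> φψ; apply: (φψ (theory_gen φ)); exact: CL_refl. Qed.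

Lemma truth_set_equiv φ ψ :
  truth_set φ = truth_set ψ -> φ ⊢ ψ /\ ψ ⊢ φ.
Proof. by move=> e; split; apply: truth_setS; rewrite e. Qed.

(** Quantifying over all [φ] with [a = truth_set φ] avoids choosing a formula and yields the full
    theory when [a] is not definable. *)
Program Definition consequents x a : theory Γ :=
  @Theory Γ [set ψ | forall φ, a = truth_set φ -> tset x (φ ⇒ ψ)%F] _ _ _.
Next Obligation.
by move=> x a φ _; apply: theory_der (CL_imp_topI _ φ) (theory_top x).
Qed.
Next Obligation.
move=> x a ψ χ ψχ xψ φ /xψ; exact/theory_der/CL_imp_mono.
Qed.
Next Obligation.
move=> x a ψ χ xψ xχ φ aφ; apply: theory_der (CL_imp_andI _ φ ψ χ) _.
by apply: theory_and; [exact: xψ|exact: xχ].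
Qed.

(** By congruence, it is immaterial which formula defines the filter. *)
Lemma consequents_truth_set x φ ψ :
  tset (consequents x (truth_set φ)) ψ <-> tset x (φ ⇒ ψ)%F.
Proof.
split=> [|xφψ χ /truth_set_equiv[φχ χφ]]; first exact.
exact: theory_der (CL_congl _ φχ χφ) xφψ.
Qed.

Program Definition theory_sel x a : order_filter (theory Γ) :=
  @Filter _ _ [set y | (consequents x a <= y)%O] _ _ _.
Next Obligation. by move=> x a; exact: lex1. Qed.
Next Obligation.
by move=> x a y z yz xay; exact: le_trans xay yz.
Qed.
Next Obligation.
by move=> x a y z /= xay xaz; rewrite lexI xay xaz.
Qed.

Program Definition canonical_frame : selection_frame (theory Γ) :=
  @SelectionFrame _ _ theory_sel _ _ _.
Next Obligation.
move=> a; rewrite eqEsubset; split=> y /=.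
  move=> /theory_leP Ty; apply: theory_eq; rewrite eqEsubset.
  by split=> // φ _; exact: Ty.
by move=> ->; exact: lex1.
Qed.
Next Obligation.
move=> x y a /theory_leP xy z /theory_leP yaz; apply/theory_leP => φ xaφ.
by apply: yaz => χ /xaφ/xy.
Qed.
Next Obligation.
(* For fixed [a], [consequents] preserves meets in [x], so the generators of the two principal
   filters serve as witnesses. *)
move=> x y a z /theory_leP xyaz; exists (consequents x a), (consequents y a).
split; [exact/theory_leP|exact/theory_leP|].
apply/theory_leP => φ [xaφ yaφ]; apply: xyaz => χ aχ.
by split; [exact: xaφ|exact: yaφ].
Qed.

(** * Truth lemma and completeness of the canonical frame *)

Local Notation s := canonical_frame.

Lemma interp_canonical φ : interp s (fun n => truth_set (Var n)) φ = truth_set φ.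
Proof.
elim: φ => //= [||φ IHφ ψ IHψ|φ IHφ ψ IHψ|φ IHφ ψ IHψ]; rewrite ?IHφ ?IHψ;
  apply: filter_eq; rewrite eqEsubset; split=> x /=.
- by move=> _; exact: theory_top.
- by [].
- by move=> ->.
- move=> xbot; apply: theory_eq; rewrite eqEsubset; split=> // φ _.
  exact: theory_der (CL_botE _ φ) xbot.
- by case=> xφ xψ; exact: theory_and.
- by move=> xφψ; split; [apply: theory_der (CL_andE1 _ _ _) xφψ
                        |apply: theory_der (CL_andE2 _ _ _) xφψ].
- case=> y [z [yφ zψ /theory_leP]]; apply.
  by split; [apply: theory_der (CL_orI1 _ _ _) yφ
            |apply: theory_der (CL_orI2 _ _ _) zψ].
(* These are the least candidates: a formula derivable from both [φ] and [ψ] is derivable from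
   [φ ∨ ψ]. *)
- move=> xφψ; exists (theory_gen φ), (theory_gen ψ).
  split; [exact: CL_refl|exact: CL_refl|].
  apply/theory_leP => χ [φχ ψχ].
  exact: theory_der (CL_or_elim φχ ψχ) xφψ.
(* The selected filter is principal, so test the inclusion at its least element. *)
- move=> xφψ; apply/consequents_truth_set; apply: (xφψ (consequents x _)).
  exact: lexx.
- by move=> /consequents_truth_set xφψ y /theory_leP; exact.
Qed.

Lemma canonical_complete φ ψ : validates s (φ ⊴ ψ) -> φ ⊢ ψ.
Proof.
move/(_ (fun n => truth_set (Var n))); rewrite !interp_canonical.
exact: truth_setS.
Qed.

(** * Transfer of implication-free pairs to arbitrary valuations *)

Lemma interp_imp_free_elim V φ x : imp_free φ -> fset (interp s V φ) x ->
  exists v : nat -> theory Γ, (forall n, fset (V n) (v n)) /\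
    forall σ, (forall n, tset (v n) (σ n)) -> tset x (subst σ φ).
Proof.
elim: φ x => //= [n||| φ IHφ ψ IHψ|φ IHφ ψ IHψ] x.
(* Letters other than [n] take the top theory, which lies in every filter. *)
- move=> _ Vx; exists (fun m => if m == n then x else theoryT Γ); split.
    by move=> m; case: eqVneq => [->|_] //; exact: filter_top.
  by move=> σ /(_ n); rewrite eqxx.
- by move=> _ _; exists (fun=> theoryT Γ); split=> [n|σ _];
    [exact: filter_top|exact: theory_top].
- by move=> _ ->; exists (fun=> theoryT Γ); split=> // n; exact: filter_top.
- case/andP=> fφ fψ [/(IHφ _ fφ)[v [Vv vφ]] /(IHψ _ fψ)[w [Vw wψ]]].
  exists (fun n => theoryI _ (v n) (w n)); split.
    by move=> n; exact: filter_meet.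
  move=> σ vwσ; apply: theory_and.
    by apply: vφ => n; case: (vwσ n).
  by apply: wψ => n; case: (vwσ n).
- case/andP=> fφ fψ [y [z [/(IHφ _ fφ)[v [Vv vφ]] /(IHψ _ fψ)[w [Vw wψ]]]]].
  move/theory_leP => yzx; exists (fun n => theoryI _ (v n) (w n)); split.
    by move=> n; exact: filter_meet.
  move=> σ vwσ; apply: yzx; split.
    by apply: theory_der (CL_orI1 _ _ _) _; apply: vφ => n; case: (vwσ n).
  by apply: theory_der (CL_orI2 _ _ _) _; apply: wψ => n; case: (vwσ n).
Qed.

(** The instances are directed: by monotonicity, the one at [σ n ∧ τ n] entails those at [σ] and at
    [τ], so consequences of single instances are closed under [∧]. *)
Lemma instance_theory (v : nat -> theory Γ) φ : imp_free φ ->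
  exists y : theory Γ, forall ψ, tset y ψ <->
    exists2 σ, (forall n, tset (v n) (σ n)) & subst σ φ ⊢ ψ.
Proof.
move=> fφ; unshelve eexists (@Theory Γ [set ψ | exists2 σ,
  (forall n, tset (v n) (σ n)) & subst σ φ ⊢ ψ] _ _ _) => //=.
- by exists (fun=> ⊤%F) => [n|]; [exact: theory_top|exact: CL_topI].
- by move=> ψ χ ψχ [σ vσ σψ]; exists σ => //; exact: CL_trans σψ ψχ.
- move=> ψ χ [σ vσ σψ] [τ vτ τχ].
  exists (fun n => σ n ∧ τ n)%F => [n|]; first exact: theory_and.
  apply: CL_and_intro; [apply: CL_trans σψ|apply: CL_trans τχ];
    apply: CL_subst_mono => // n; [exact: CL_andE1|exact: CL_andE2].
Qed.

Lemma interp_imp_free_intro V φ x (v : nat -> theory Γ) : imp_free φ ->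
  (forall n, fset (V n) (v n)) ->
  (forall σ, (forall n, tset (v n) (σ n)) -> tset x (subst σ φ)) ->
  fset (interp s V φ) x.
Proof.
move=> + Vv; elim: φ x => //= [n||φ IHφ ψ IHψ|φ IHφ ψ IHψ] x.
- move=> _ vx; apply: filter_up (Vv n); apply/theory_leP => φ vφ.
  have /= := vx (fun m => if m == n then φ else ⊤%F); rewrite eqxx; apply=> m.
  by case: eqVneq => [->|_] //; exact: theory_top.
- move=> _ /(_ (fun=> ⊤%F))vx; apply: theory_eq; rewrite eqEsubset; split=> // φ _.
  by apply: theory_der (CL_botE _ φ) (vx _) => n; exact: theory_top.
- case/andP=> fφ fψ vx; split.
    by apply: IHφ => // σ /vx; apply: theory_der; exact: CL_andE1.
  by apply: IHψ => // σ /vx; apply: theory_der; exact: CL_andE2.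
- case/andP=> fφ fψ vx.
  (* The instances of [φ] and of [ψ] generate the two witnesses; a common consequence then follows
     from one instance of [φ ∨ ψ] in [x]. *)
  have [y yE] := instance_theory v φ fφ; have [z zE] := instance_theory v ψ fψ.
  exists y, z; split.
  + by apply: IHφ => // σ vσ; apply/yE; exists σ => //; exact: CL_refl.
  + by apply: IHψ => // σ vσ; apply/zE; exists σ => //; exact: CL_refl.
  + apply/theory_leP => θ [/yE[σ vσ σθ] /zE[τ vτ τθ]].
    have vστ n : tset (v n) (σ n ∧ τ n)%F by exact: theory_and.
    apply: theory_der (vx _ vστ); apply: CL_or_elim.
      apply: CL_trans σθ; apply: CL_subst_mono => // n; exact: CL_andE1.
    apply: CL_trans τθ; apply: CL_subst_mono => // n; exact: CL_andE2.
Qed.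

(** Closure under substitution carries [φ ⊢ ψ] to every instance, so the choice [v] found for [φ]
    also works for [ψ]. *)
Lemma canonical_imp_free φ ψ :
  imp_free φ -> imp_free ψ -> φ ⊢ ψ -> validates s (φ ⊴ ψ).
Proof.
move=> fφ fψ φψ V x /(interp_imp_free_elim _ _ _ fφ)[v [Vv vφ]].
apply: (interp_imp_free_intro _ _ _ v fψ Vv) => σ /vφ.
exact/theory_der/CL_subst.
Qed.

(** * The named axioms in the canonical frame *)

Local Notation letters φ ψ :=
  (fun n => match n with 0 => φ | _ => ψ end).

(** For definable [V 0] an instance of the axiom applies; otherwise [consequents x (V 0)] is full
    and only the top is selected. *)
Lemma canonical_refl : CL Γ ax_refl -> validates s ax_refl.
Proof.
move=> H V x _ y /theory_leP xy.
have [[φ Vφ]|nV] := pselect (exists φ, V 0 = truth_set φ).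
  rewrite /= Vφ; apply: xy; rewrite Vφ; apply/consequents_truth_set.
  exact: theory_der (CL_subst (fun=> φ) H) (theory_top x).
suff -> : y = \top%O by exact: filter_top.
apply: theory_eq; rewrite eqEsubset; split=> // ψ _; apply: xy => φ Vφ.
by case: nV; exists φ.
Qed.

Lemma filterT_truth_set : filterT (theory Γ) = truth_set ⊤.
Proof. by rewrite -interp_canonical. Qed.

Lemma filter1_truth_set : filter1 (theory Γ) = truth_set ⊥.
Proof. by rewrite -interp_canonical. Qed.

(** The axiom puts [x] below every theory selected along [⊤], so upward closure of [V 0]
    concludes. *)
Lemma canonical_cond : CL Γ ax_cond -> validates s ax_cond.
Proof.
move=> H V x Vx y /= /theory_leP xy; apply: filter_up Vx.
apply/theory_leP => φ xφ; apply: xy.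
rewrite filterT_truth_set; apply/consequents_truth_set.
exact: theory_der (CL_subst (fun=> φ) H) xφ.
Qed.

Lemma canonical_veq : CL Γ ax_veq -> validates s ax_veq.
Proof.
move=> H V x Vx y /theory_leP xy; apply: filter_up Vx.
apply/theory_leP => ψ xψ; apply: xy => φ _.
exact: theory_der (CL_subst (letters ψ φ) H) xψ.
Qed.

(** If [φ] defines [V 0], then [φ] lies in [x], so the axiom yields [φ ⇒ ψ] in [x] for each [ψ] in
    [x]. *)
Lemma canonical_cs : CL Γ ax_cs -> validates s ax_cs.
Proof.
move=> H V x [V0x V1x] y /theory_leP xy; apply: filter_up V1x.
apply/theory_leP => ψ xψ; apply: xy => φ /= V0φ.
apply: theory_der (CL_subst (letters φ ψ) H) _.
by apply: theory_and => //; rewrite /= V0φ in V0x.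
Qed.

Lemma canonical_det : CL Γ ax_det -> validates s ax_det.
Proof.
(* Test at [x] itself, which is selected because [⊤ ⇒ φ] in [x] gives [φ] in [x]. *)
move=> H V x; apply; apply/theory_leP => φ.
rewrite /= filterT_truth_set => /consequents_truth_set.
exact/theory_der/(CL_subst (fun=> φ) H).
Qed.

Lemma canonical_expl : CL Γ ax_expl -> validates s ax_expl.
Proof.
move=> H V x _ y /= /theory_leP xy.
suff -> : y = \top%O by exact: filter_top.
apply: theory_eq; rewrite eqEsubset; split=> // φ _; apply: xy.
rewrite filter1_truth_set; apply/consequents_truth_set.
exact: theory_der (CL_subst (fun=> φ) H) (theory_top x).
Qed.

Lemma canonical_validates c :
  (named_axioms `|` imp_free_pairs) c -> CL Γ c -> validates s c.
Proof.
case: c => φ ψ [[[[[[->|->]|->]|->]|->]|->]|/andP[/= fφ fψ]].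
- exact: canonical_refl.
- exact: canonical_cond.
- exact: canonical_veq.
- exact: canonical_cs.
- exact: canonical_det.
- exact: canonical_expl.
- exact: canonical_imp_free.
Qed.

End CanonicalFrame.

Theorem theorem5p6 (Ax : set cpair)
    (hAx : Ax `<=` named_axioms `|` imp_free_pairs) (c : cpair) :
  CL Ax c <->
  (forall (d : Order.disp_t) (X : tMeetSemilatticeType d) (s : selection_frame X),
     (forall a : cpair, Ax a -> validates s a) -> validates s c).
Proof.
split=> [Axc d X s sAx|valid]; first exact: CL_sound sAx Axc.
case: c valid => φ ψ /(_ _ _ (canonical_frame Ax)) valid.
(* [Ax] is contained in [CL Ax], so the canonical frame belongs to the class. *)
apply: canonical_complete; apply: valid => a Axa.
by apply: canonical_validates (hAx _ Axa) _; exact: CL_hyp.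
Qed.
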